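(* For all $n\ge 1$ one has $\mathrm{Tot}^{\kappa}(L_{2n})=\mathrm{Tot}^{\kappa}(L_{2n+1})=2n+1$.
   Context: $(L_n)_{n\ge0}$ are the Lucas numbers: $L_0=2$, $L_1=1$, $L_{n+1}=L_n+L_{n-1}$ for $n\ge1$. Let $\varphi=(1+\sqrt5)/2$. A finite base phi expansion of a natural number $N$ is a sequence $(a_i)_{i\in\mathbb Z}$ with $a_i\in\{0,1\}$, only finitely many $a_i$ nonzero, and $N=\sum_i a_i\varphi^i$. A Knott expansion of $N$ is a finite base phi expansion $(a_i)$ of $N$ such that, if $R$ denotes the smallest index with $a_R=1$, then $a_{R+2}a_{R+1}a_R\neq 011$. The number of Knott expansions of $N$ is denoted $\mathrm{Tot}^{\kappa}(N)$. *)

(* Defs.v *)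
From HB Require Import structures.
From mathcomp Require Import all_boot all_order all_algebra.
From mathcomp Require Import finmap.
From mathcomp Require Import boolp classical_sets cardinality reals.

Set Implicit Arguments.
Unset Strict Implicit.
Unset Printing Implicit Defensive.

Import Order.TTheory GRing.Theory Num.Theory.

Local Open Scope classical_set_scope.
Local Open Scope ring_scope.

Fixpoint lucas (n : nat) : nat :=
  match n with
  | 0 => 2%N
  | 1 => 1%N
  | (m.+1 as p).+1 => (lucas p + lucas m)%N
  end.

Definition phi (R : realType) : R := (1 + Num.sqrt 5%:R) / 2%:R.

(* Digit sequences indexed by all integers, with only finitely many nonzero
   digits; true and false are the digits 1 and 0. *)
Definition digits := {fsfun int -> bool with false}.

Definition phi_expansion (R : realType) (N : nat) (a : digits) : Prop :=
  N%:R = \sum_(i <- finsupp a) (a i)%:R * phi R ^ i.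

Definition smallest_one (a : digits) (r : int) : Prop :=
  a r = true /\ forall i : int, i < r -> a i = false.

Definition knott_expansion (R : realType) (N : nat) (a : digits) : Prop :=
  phi_expansion R N a /\
  forall r : int, smallest_one a r ->
    (a (r + 2), a (r + 1), a r) <> (false, true, true).

(* fset_set sends an infinite set to the empty one, so any nonzero value of
   tot_knott entails that the set of Knott expansions is finite. *)
Definition tot_knott (R : realType) (N : nat) : nat :=
  #|` fset_set [set a : digits | knott_expansion R N a] |.

(* Main.v *)
Require Import Defs.
From mathcomp Require Import all_boot all_order all_algebra reals.
From mathcomp Require Import finmap zify ring lra.
From mathcomp Require Import boolp classical_sets cardinality.

Set Implicit Arguments.
Unset Strict Implicit.
Unset Printing Implicit Defensive.

Import Order.TTheory GRing.Theory Num.Theory.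

Local Open Scope classical_set_scope.
Local Open Scope ring_scope.

(** An expansion of N is read from its most significant digit downwards, keeping
    track of the remainder: the value [tail a k] of the digits at positions at
    most k. Since phi ^ 2 = phi + 1 and only finitely many digits are nonzero,
    0 <= tail a k < phi ^ (k + 2) ([tail_lt]). So the digit at k is forced to be
    0 when the remainder is less than phi ^ k and to be 1 when it is at least
    phi ^ (k + 1); there is a choice only in between.

    For L_(2n) = phi ^ 2n + phi ^ (-2n), the remainder at k = 2n, 2n-2, ... is
    phi ^ k + phi ^ (-2n) as long as all choices made are 0. Choosing 1 at k
    leaves phi ^ (-2n); choosing 0 forces a 1 at k - 1 and leaves
    phi ^ (k - 2) + phi ^ (-2n), which is the same situation two places lower. For
    L_(2n+1) = phi ^ (2n+1) - phi ^ (-2n-1), the remainder at k = 2n+1, 2n-1, ...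
    is phi ^ k - phi ^ (-2n-1), so that the digit at k is 0. Choosing 1 at
    k - 1 leads to the same situation two places lower; choosing 0 there forces
    a block of ones down to position -2n, leaving phi ^ (-2n) to be written
    strictly below -2n.

    Thus every branch reaches a remainder that is a power of phi, and there the
    Knott condition decides: a power phi ^ c can be written at positions at most
    c as the single digit 1 at c, or by replacing a final 1 repeatedly by 011,
    and each of these replacements produces the forbidden ending
    ([tail_phiz_head], [tail_phiz_below], [tail_phiz_above]). Each branch hence
    has one continuation. The branches are indexed by the number t of times that
    the situation has moved two places down, with 0 <= t <= 2n, which gives 2n + 1
    expansions. [even_positions] and [odd_positions] list their nonzero digits. *)

(** * Powers of the golden ratio and Lucas numbers *)

Lemma phi_gt1 (R : realType) : 1 < phi R.
Proof.
have s1 : 1 < Num.sqrt 5%:R :> R by rewrite -{1}sqrtr1 ltr_sqrt ?ltr1n.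
by rewrite /phi ltr_pdivlMr ?ltr0n //; lra.
Qed.

Lemma phi_gt0 (R : realType) : 0 < phi R.
Proof. exact: lt_trans ltr01 (phi_gt1 R). Qed.

Lemma phi_neq0 (R : realType) : phi R != 0.
Proof. by rewrite gt_eqF ?phi_gt0. Qed.

Lemma phi_sqr (R : realType) : phi R ^+ 2 = phi R + 1.
Proof.
have s5 : Num.sqrt 5%:R ^+ 2 = 5%:R :> R by rewrite sqr_sqrtr ?ler0n.
by rewrite /phi; move: s5; set s := Num.sqrt _ => s5; field: s5.
Qed.

Lemma phiz_gt0 (R : realType) (i : int) : 0 < phi R ^ i.
Proof. by rewrite exprz_gt0 ?phi_gt0. Qed.

Lemma ler_phiz (R : realType) (i j : int) : (phi R ^ i <= phi R ^ j) = (i <= j).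
Proof. by rewrite ler_eXz2l ?phi_gt1. Qed.

Lemma ltr_phiz (R : realType) (i j : int) : (phi R ^ i < phi R ^ j) = (i < j).
Proof. by rewrite ltr_eXz2l ?phi_gt1. Qed.

Lemma phiz_rec (R : realType) (i j k : int) :
  j = i + 1 -> k = i + 2 -> phi R ^ k = phi R ^ j + phi R ^ i.
Proof.
move=> -> ->; have -> : i + 2 = i + 1 + 1 by lia.
rewrite !expfzDr ?phi_neq0 // !expr1z -mulrA -expr2 phi_sqr; ring.
Qed.

(** Binet's formula: the second root of x ^ 2 = x + 1 is - 1 / phi. *)
Lemma lucasE (R : realType) (m : nat) :
  (lucas m)%:R = phi R ^+ m + (- (phi R)^-1) ^+ m.
Proof.
have q2 : (- (phi R)^-1) ^+ 2 = - (phi R)^-1 + 1.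
  have := phi_sqr R; have := phi_neq0 R; set p := phi R => p0 p2.
  by field: p2.
have [] // : (lucas m)%:R = phi R ^+ m + (- (phi R)^-1) ^+ m /\
   (lucas m.+1)%:R = phi R ^+ m.+1 + (- (phi R)^-1) ^+ m.+1.
elim: m => [|m [IH1 IH2]].
  split; first by rewrite !expr0.
  rewrite !expr1 /=.
  have := phi_sqr R; have := phi_neq0 R; set p := phi R => p0 p2.
  by field: p2.
split=> //.
have -> : lucas m.+2 = (lucas m.+1 + lucas m)%N by [].
rewrite natrD IH1 IH2 -[m.+2]addn2 -[m.+1]addn1 !exprD phi_sqr q2 !expr1.
ring.
Qed.

Lemma lucas_even (R : realType) (n : nat) :
  (lucas (2 * n))%:R = phi R ^ (2 * n%:Z) + phi R ^ (- (2 * n%:Z)).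
Proof.
have -> : 2 * n%:Z = (2 * n)%N by lia.
by rewrite lucasE [in (- _) ^+ _]exprM sqrrN -exprM -exprnN exprVn.
Qed.

Lemma lucas_odd (R : realType) (n : nat) :
  (lucas (2 * n + 1))%:R =
    phi R ^ (2 * n%:Z + 1) - phi R ^ (- (2 * n%:Z) - 1).
Proof.
have -> : - (2 * n%:Z) - 1 = - Posz (2 * n + 1)%N by lia.
have -> : 2 * n%:Z + 1 = (2 * n + 1)%N by lia.
rewrite lucasE -exprnN -exprVn; congr (_ + _).
by rewrite exprNn addn1 exprS mulnC exprM sqrr_sign mulr1 mulN1r.
Qed.

(** * Remainders of an expansion *)

Definition tail (R : realType) (a : digits) (k : int) : R :=
  \sum_(i <- finsupp a | i <= k) phi R ^ i.

Lemma finsupp_digit (a : digits) (i : int) : (i \in finsupp a) = a i.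
Proof. by rewrite mem_finsupp; case: (a i). Qed.

Lemma tail_rec (R : realType) (a : digits) (k : int) :
  tail R a k = (if a k then phi R ^ k else 0) + tail R a (k - 1).
Proof.
rewrite /tail; case: ifP => ak; last first.
  rewrite add0r big_seq_cond [RHS]big_seq_cond; apply: eq_bigl => i.
  rewrite finsupp_digit; have [->|ne] := eqVneq i k; first by rewrite ak.
  by congr andb; lia.
rewrite big_mkcond (bigD1_seq k) ?fset_uniq ?finsupp_digit //= lexx.
congr (_ + _); rewrite -big_mkcondr; apply: eq_bigl => i.
by lia.
Qed.

Lemma tail_ge0 (R : realType) (a : digits) (k : int) : 0 <= tail R a k.
Proof. by apply: sumr_ge0 => i _; rewrite ltW ?phiz_gt0. Qed.

Lemma digits_lower_bound (a : digits) :
  exists m : int, forall i, i <= m -> a i = false.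
Proof.
exists (- (\sum_(i <- finsupp a) `|i|) - 1) => i im.
apply/negP; rewrite -finsupp_digit => ia.
have : `|i| <= \sum_(j <- finsupp a) `|j|.
  rewrite (bigD1_seq i) ?fset_uniq //= lerDl.
  by apply: sumr_ge0 => j _; rewrite normr_ge0.
by move: im; set s := \sum_(j <- _) _; lia.
Qed.

Lemma tail_eq0P (R : realType) (a : digits) (k : int) :
  tail R a k = 0 <-> forall i, i <= k -> a i = false.
Proof.
split=> [/eqP|a0].
  rewrite psumr_eq0 => [/allP t0 i ik|i _]; last by rewrite ltW ?phiz_gt0.
  apply/negP; rewrite -finsupp_digit => /t0.
  by rewrite ik gt_eqF ?phiz_gt0.
rewrite /tail big_seq_cond big_pred0 // => i.
by rewrite finsupp_digit; apply/negP => /andP[+ /a0 ai]; rewrite ai.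
Qed.

(** Digit sequences extend downwards without a fixed end, so the inductions
    start from the position below which all digits vanish. *)
Lemma int_ind_from (m : int) (P : int -> Prop) :
  (forall k, k <= m -> P k) ->
  (forall k, P (k - 2) -> P (k - 1) -> P k) -> forall k, P k.
Proof.
move=> P0 PS k.
have H (n : nat) : forall k, k <= m + n%:Z -> P k.
  elim: n => [|n IH] j jn; first by apply: P0; lia.
  have [/IH //|mj] := leP j (m + n%:Z).
  by apply: PS; apply: IH; lia.
have [/P0 //|mk] := leP k m.
by apply: (H `|k - m|%N); lia.
Qed.

(** The infinite word 111... starting at k has value phi ^ (k + 2); the
    inequality is strict because the digits vanish from some point on. *)
Lemma tail_lt (R : realType) (a : digits) (k : int) :
  tail R a k < phi R ^ (k + 2).
Proof.
have [m a0] := digits_lower_bound a.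
elim/(@int_ind_from m): k => [k km|k _ IH].
  have -> : tail R a k = 0 by apply/tail_eq0P => i ik; apply: a0; lia.
  exact: phiz_gt0.
rewrite tail_rec (@phiz_rec R k (k + 1) (k + 2)) //.
have -> : k + 1 = k - 1 + 2 by lia.
by have := phiz_gt0 R k; case: ifP => _ ?; lra.
Qed.

Lemma digit0 (R : realType) (a : digits) (k : int) :
  tail R a k < phi R ^ k -> a k = false.
Proof.
move=> tk; apply/negP => ak; move: tk; rewrite tail_rec ak.
by have := tail_ge0 R a (k - 1); lra.
Qed.

Lemma digit1 (R : realType) (a : digits) (k : int) :
  phi R ^ (k + 1) <= tail R a k -> a k = true.
Proof.
move=> tk; apply/negPn/negP => /negbTE ak; move: tk; rewrite tail_rec ak.
have := tail_lt R a (k - 1); have -> : k - 1 + 2 = k + 1 by lia.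
by lra.
Qed.

Lemma tail_digit0 (R : realType) (a : digits) (k : int) :
  a k = false -> tail R a (k - 1) = tail R a k.
Proof. by move=> ak; rewrite [RHS]tail_rec ak add0r. Qed.

Lemma tail_digit1 (R : realType) (a : digits) (k : int) :
  a k = true -> tail R a (k - 1) = tail R a k - phi R ^ k.
Proof. by move=> ak; rewrite [tail R a k]tail_rec ak addrAC subrr add0r. Qed.

(** * Expansions of a power of the golden ratio *)

Definition knott_ending (a : digits) : Prop :=
  forall r : int, smallest_one a r ->
    (a (r + 2), a (r + 1), a r) <> (false, true, true).

(** A 0 at position k would force a 1 at k - 1 and leave phi ^ (k - 2) to be
    written at positions at most k - 2. By induction the expansion would then stop
    with a 1 at k - 2, that is, with the forbidden ending 011. *)
Lemma tail_phiz_head (R : realType) (a : digits) (k : int) :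
  knott_ending a -> tail R a k = phi R ^ k ->
  a k = true /\ forall i, i < k -> a i = false.
Proof.
move=> Ka; have [m a0] := digits_lower_bound a.
elim/(@int_ind_from m): k => [k km tk|k IH _ tk].
  have t0 : tail R a k = 0 by apply/tail_eq0P => i ik; apply: a0; lia.
  by have := phiz_gt0 R k; rewrite -tk t0 ltxx.
case ak: (a k).
  split=> // i ik; apply: (proj1 (tail_eq0P R a (k - 1))); last by lia.
  by rewrite tail_digit1 // tk subrr.
have t1 : tail R a (k - 1) = phi R ^ k by rewrite tail_digit0.
have a1 : a (k - 1) = true.
  by apply: (@digit1 R); rewrite t1 ler_phiz; lia.
have t2 : tail R a (k - 2) = phi R ^ (k - 2).
  have -> : k - 2 = k - 1 - 1 by lia.
  rewrite tail_digit1 // t1 (@phiz_rec R (k - 1 - 1) (k - 1) k); [|lia..].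
  by rewrite addrC addKr.
have [a2 low] := IH t2; exfalso; apply: (Ka (k - 2)); first by split.
by rewrite a2 subrK ak (_ : k - 2 + 1 = k - 1) ?a1 //; lia.
Qed.

Lemma tail_phiz_below (R : realType) (a : digits) (c j i : int) :
  knott_ending a -> c <= j -> tail R a j = phi R ^ c ->
  i <= j -> a i = (i == c).
Proof.
move=> Ka cj tj ij.
have skip (d : nat) : forall j', j' = c + d%:Z -> tail R a j' = phi R ^ c ->
    forall i', i' <= j' -> a i' = (i' == c).
  elim: d => [|d IH] k kc tk i' ik.
    have [ac low] : a c = true /\ forall i, i < c -> a i = false.
      apply: (@tail_phiz_head R) => //.
      by rewrite -tk kc addr0.
    have [->//|ne] := eqVneq i' c; apply: low; lia.
  have ak : a k = false by apply: (@digit0 R); rewrite tk ltr_phiz; lia.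
  have [->|ne] := eqVneq i' k; first by rewrite ak; apply/esym/negbTE; lia.
  by apply: (IH (k - 1)); rewrite ?tail_digit0 //; lia.
by apply: (skip `|j - c|%N j) => //; lia.
Qed.

(** All the digits from k downwards are worth less than phi ^ (k + 2), so
    phi ^ (k + 1) = phi ^ k + phi ^ (k - 1) can still be written there. It
    takes a 1 at k, after which [tail_phiz_head] applies to phi ^ (k - 1). *)
Lemma tail_phiz_above (R : realType) (a : digits) (k i : int) :
  knott_ending a -> tail R a k = phi R ^ (k + 1) ->
  i <= k -> a i = (k - 1 <= i).
Proof.
move=> Ka tk ik.
have ak : a k = true by apply: (@digit1 R); rewrite tk.
have t1 : tail R a (k - 1) = phi R ^ (k - 1).
  rewrite tail_digit1 // tk (@phiz_rec R (k - 1) k (k + 1)); [|lia..].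
  by rewrite addrC addKr.
have [->|ne] := eqVneq i k; first by rewrite ak; apply/esym; lia.
rewrite (tail_phiz_below Ka (lexx _) t1); last by lia.
by apply/eqP/idP; lia.
Qed.

(** The remainder phi ^ (j + 2) - phi ^ c is so close to the supremum
    phi ^ (j + 2) of what positions up to j can represent that no digit above c
    may be 0. *)
Lemma tail_ones (R : realType) (a : digits) (c j : int) :
  c <= j -> tail R a j = phi R ^ (j + 2) - phi R ^ c ->
  tail R a c = phi R ^ (c + 1) /\ forall i, c < i -> i <= j -> a i = true.
Proof.
move=> cj.
have [d ->] : exists d : nat, j = c + d%:Z by exists `|j - c|%N; lia.
elim: d => [|d IH] tj.
  rewrite addr0 in tj *; split; last by move=> i; lia.
  by rewrite tj (@phiz_rec R c (c + 1) (c + 2)) // addrK.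
set k := c + d.+1 in tj *.
have pk : phi R ^ (k + 2) = phi R ^ (k + 1) + phi R ^ k by exact: phiz_rec.
have ck : phi R ^ c < phi R ^ k by rewrite ltr_phiz /k; lia.
have ak : a k = true by apply: (@digit1 R); rewrite tj pk; lra.
have kE : c + d%:Z = k - 1 by rewrite /k; lia.
rewrite kE in IH; case: IH => [|tc ones].
  rewrite tail_digit1 // tj pk (_ : k - 1 + 2 = k + 1); last by lia.
  by ring.
split=> // i ci ik; have [->//|ne] := eqVneq i k.
by apply: ones; lia.
Qed.

(** * From digit sequences to counting *)

Lemma expansion_tail (R : realType) (N : nat) (a : digits) (k : int) :
  phi_expansion R N a -> N%:R < phi R ^ (k + 1) ->
  tail R a k = N%:R /\ forall i, k < i -> a i = false.
Proof.
rewrite /phi_expansion => aN Nk.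
have Na : N%:R = \sum_(i <- finsupp a) phi R ^ i.
  rewrite aN; apply: eq_big_seq => i.
  by rewrite finsupp_digit => ->; rewrite mul1r.
have high i : k < i -> a i = false.
  move=> ki; apply/negP; rewrite -finsupp_digit => ai.
  have : phi R ^ i <= N%:R.
    rewrite Na (bigD1_seq i) ?fset_uniq //= lerDl.
    by apply: sumr_ge0 => j _; rewrite ltW ?phiz_gt0.
  have : phi R ^ (k + 1) <= phi R ^ i by rewrite ler_phiz; lia.
  by lra.
split=> //; rewrite /tail Na [LHS]big_seq_cond [RHS]big_seq_cond.
apply: eq_bigl => i; rewrite andbT andb_idr // finsupp_digit => ai.
by rewrite leNgt; apply/negP => /high; rewrite ai.
Qed.

Definition digits_of (s : seq int) : digits :=
  [fsfun i in [fset j in s]%fset => true | false].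

Lemma digits_ofE (s : seq int) (i : int) : digits_of s i = (i \in s).
Proof. by rewrite fsfunE inE; case: ifP. Qed.

Lemma phi_expansion_digits_of (R : realType) (N : nat) (s : seq int) :
  uniq s -> \sum_(i <- s) phi R ^ i = N%:R -> phi_expansion R N (digits_of s).
Proof.
move=> us sN; rewrite /phi_expansion -sN.
rewrite [RHS](perm_big s) /=.
  by apply: eq_big_seq => i; rewrite digits_ofE => ->; rewrite mul1r.
apply: uniq_perm; rewrite ?fset_uniq // => i.
by rewrite finsupp_digit digits_ofE.
Qed.

(** The Knott condition may be checked at any position known to carry the
    last 1. *)
Lemma knott_ending_min (a : digits) (r : int) :
  a r = true -> (forall i, i < r -> a i = false) ->
  (a (r + 2), a (r + 1)) <> (false, true) -> knott_ending a.
Proof.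
move=> ar low ne r' [ar' low'].
have -> : r' = r.
  apply/eqP; rewrite eq_le !leNgt.
  by apply/andP; split; apply/negP; [move/low'|move/low]; rewrite ?ar ?ar'.
by move=> [e1 e2 _]; apply: ne; rewrite e1 e2.
Qed.

Lemma card_fset_set_param (T : choiceType) (A : set T) (m : nat) (w : nat -> T) :
  (forall t, (t < m)%N -> A (w t)) ->
  (forall x, A x -> exists2 t, (t < m)%N & x = w t) ->
  (forall t u, (t < u < m)%N -> w t <> w u) ->
  #|` fset_set A| = m.
Proof.
move=> wA Aw wI; apply: card_fset_set.
have -> : A = w @` `I_m.
  apply/seteqP; split=> [x /Aw[t tm ->]|x [t tm <-]]; last exact: wA.
  by exists t.
apply: inj_card_eq => t u; rewrite !inE /= => tm um e.
by case: (ltngtP t u) => // tu; exfalso; [apply: (wI t u)|apply: (wI u t)];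
  rewrite ?e // ?tu.
Qed.

(** * The expansions of the two families of Lucas numbers *)

Definition run (step : int) (hi : int) (t : nat) : seq int :=
  [seq hi - step * j%:Z | j <- iota 0 t].

Arguments run : simpl never.

Lemma run1E (hi i : int) (t : nat) :
  (i \in run 1 hi t) = (hi - t%:Z < i) && (i <= hi).
Proof.
apply/mapP/idP => [[j]|/andP[lo up]]; first by rewrite mem_iota => jt ->; lia.
by exists `|hi - i|%N; rewrite ?mem_iota; lia.
Qed.

Lemma run2E (hi i : int) (t : nat) :
  (i \in run 2 hi t) = [&& hi - 2 * t%:Z < i, i <= hi & ((hi - i) %% 2 == 0)%Z].
Proof.
apply/mapP/idP => [[j]|/and3P[lo up dv]]; first by rewrite mem_iota => jt ->; lia.
by exists `|((hi - i) %/ 2)%Z|%N; rewrite ?mem_iota; lia.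
Qed.

Lemma run_uniq (step hi : int) (t : nat) : step != 0 -> uniq (run step hi t).
Proof.
move=> s0; rewrite map_inj_uniq ?iota_uniq // => j k e.
by have /(mulfI s0) [] : step * j%:Z = step * k%:Z by lia.
Qed.

Lemma runS (step hi : int) (t : nat) :
  run step hi t.+1 = rcons (run step hi t) (hi - step * t%:Z).
Proof. by rewrite /run -addn1 iotaD map_cat cats1. Qed.

Lemma sum_run1 (R : realType) (hi : int) (t : nat) :
  \sum_(i <- run 1 hi t) phi R ^ i = phi R ^ (hi + 2) - phi R ^ (hi + 2 - t%:Z).
Proof.
elim: t => [|t IH]; first by rewrite big_nil subr0 subrr.
rewrite runS big_rcons /= IH.
rewrite (@phiz_rec R (hi - 1 * t%:Z) (hi + 2 - t.+1%:Z) (hi + 2 - t%:Z)); [|lia..].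
ring.
Qed.

Lemma sum_run2 (R : realType) (hi : int) (t : nat) :
  \sum_(i <- run 2 hi t) phi R ^ i =
    phi R ^ (hi + 1) - phi R ^ (hi + 1 - 2 * t%:Z).
Proof.
elim: t => [|t IH]; first by rewrite big_nil mulr0 subr0 subrr.
rewrite runS big_rcons /= IH.
rewrite (@phiz_rec R (hi + 1 - 2 * t.+1%:Z) (hi - 2 * t%:Z) (hi + 1 - 2 * t%:Z)); [|lia..].
ring.
Qed.

(** In each of the t steps down, the digit at k was 0 and the digit at k - 1 was
    1. For t < 2n the branch then ends with a 1 at k = 2n - 2t, leaving
    phi ^ (-2n). For t = 2n the position k is -2n itself and the remainder
    2 phi ^ (-2n) is written with ones at -2n, -2n - 1 and -2n - 2. *)
Definition even_positions (n t : nat) : seq int :=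
  run 2 (2 * n%:Z - 1) t ++
  if (t < 2 * n)%N then [:: 2 * n%:Z - 2 * t%:Z; - (2 * n%:Z)]
  else run 1 (- (2 * n%:Z)) 3.

(** Here k = 2n + 1 - 2t. For t < 2n the branch ends with a 0 at k - 1 and ones
    from k - 2 down to -2n - 2. For t = 2n this would end in 011; the remainder is
    then phi ^ (-2n) with the digit at -2n still free, so that a single 1 there
    completes the expansion. *)
Definition odd_positions (n t : nat) : seq int :=
  run 2 (2 * n%:Z) t ++
  if (t < 2 * n)%N then run 1 (2 * n%:Z - 1 - 2 * t%:Z) (4 * n + 2 - 2 * t)
  else [:: - (2 * n%:Z)].

Lemma even_knott (R : realType) (n t : nat) :
  (t <= 2 * n)%N ->
  knott_expansion R (lucas (2 * n)) (digits_of (even_positions n t)).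
Proof.
move=> tn; split.
  apply: phi_expansion_digits_of.
    rewrite /even_positions cat_uniq run_uniq //; apply/and3P; split=> //.
      apply/hasPn => i.
      by case: ifP => t2; rewrite ?run1E ?inE /mem /= run2E; lia.
    by case: ifP => t2; rewrite ?run_uniq //= !inE; lia.
  rewrite lucas_even big_cat sum_run2 /=; case: ifP => t2.
    rewrite !big_cons big_nil subrK; ring.
  rewrite sum_run1.
  rewrite (_ : - (2 * n%:Z) + 2 - 3 = - (2 * n%:Z) - 1); last by lia.
  rewrite (_ : 2 * n%:Z - 1 + 1 - 2 * t%:Z = - (2 * n%:Z)); last by lia.
  rewrite (_ : 2 * n%:Z - 1 + 1 = 2 * n%:Z); last by lia.
  rewrite (@phiz_rec R (- (2 * n%:Z)) (- (2 * n%:Z) + 1) (- (2 * n%:Z) + 2)) //.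
  rewrite (@phiz_rec R (- (2 * n%:Z) - 1) (- (2 * n%:Z)) (- (2 * n%:Z) + 1)); [|lia..].
  ring.
apply: (@knott_ending_min _
  (if (t < 2 * n)%N then - (2 * n%:Z) else - (2 * n%:Z) - 2)).
- rewrite digits_ofE mem_cat run2E; case: ifP => t2; rewrite ?run1E ?inE; lia.
- move=> i; rewrite digits_ofE mem_cat run2E; case: ifP => t2; rewrite ?run1E ?inE; lia.
- rewrite !digits_ofE !mem_cat !run2E; case: ifP => t2; rewrite ?run1E ?inE; case; lia.
Qed.

Lemma odd_knott (R : realType) (n t : nat) :
  (t <= 2 * n)%N ->
  knott_expansion R (lucas (2 * n + 1)) (digits_of (odd_positions n t)).
Proof.
move=> tn; split.
  apply: phi_expansion_digits_of.
    rewrite /odd_positions cat_uniq run_uniq //; apply/and3P; split=> //.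
      apply/hasPn => i.
      by case: ifP => t2; rewrite ?run1E ?inE /mem /= run2E; lia.
    by case: ifP => t2; rewrite ?run_uniq.
  rewrite lucas_odd big_cat sum_run2 /=; case: ifP => t2.
    rewrite sum_run1.
    rewrite (_ : 2 * n%:Z - 1 - 2 * t%:Z + 2 - _ = - (2 * n%:Z) - 1); last by lia.
    rewrite (_ : 2 * n%:Z - 1 - 2 * t%:Z + 2 = 2 * n%:Z + 1 - 2 * t%:Z); last by lia.
    ring.
  rewrite big_seq1.
  rewrite (@phiz_rec R (- (2 * n%:Z) - 1) (- (2 * n%:Z)) (2 * n%:Z + 1 - 2 * t%:Z)); [|lia..].
  ring.
apply: (@knott_ending_min _
  (if (t < 2 * n)%N then - (2 * n%:Z) - 2 else - (2 * n%:Z))).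
- rewrite digits_ofE mem_cat run2E; case: ifP => t2; rewrite ?run1E ?inE; lia.
- move=> i; rewrite digits_ofE mem_cat run2E; case: ifP => t2; rewrite ?run1E ?inE; lia.
- rewrite !digits_ofE !mem_cat !run2E; case: ifP => t2; rewrite ?run1E ?inE; case; lia.
Qed.

(** The position tested is the first at which the branch t leaves the sequence
    of steps down: the branch t has a 1 there, and the later ones a 0. *)
Lemma even_positions_inj (n t u : nat) : (t < u <= 2 * n)%N ->
  digits_of (even_positions n t) <> digits_of (even_positions n u).
Proof.
move=> tu; pose k := 2 * n%:Z - 2 * t%:Z.
move=> /(congr1 (fun a : digits => a k)).
rewrite !digits_ofE !mem_cat !run2E.
by do 2![case: ifP => ?]; rewrite ?run1E ?inE /k; lia.
Qed.

(** At the position where the branch t leaves the sequence of steps down it has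
    a 0, whereas the later ones have a 1. *)
Lemma odd_positions_inj (n t u : nat) : (t < u <= 2 * n)%N ->
  digits_of (odd_positions n t) <> digits_of (odd_positions n u).
Proof.
move=> tu; pose k := 2 * n%:Z - 2 * t%:Z.
move=> /(congr1 (fun a : digits => a k)).
rewrite !digits_ofE !mem_cat !run2E.
by do 2![case: ifP => ?]; rewrite ?run1E ?inE /k; lia.
Qed.

Lemma digits_ext (a : digits) (s : seq int) (k : int) :
  (forall i, k < i -> a i = (i \in s)) ->
  (forall i, i <= k -> a i = (i \in s)) -> a = digits_of s.
Proof.
move=> hi lo; apply/fsfunP => i; rewrite digits_ofE.
by have [/lo|/hi] := leP i k.
Qed.

(** The invariant of the descent: either the expansion has already left it at
    one of the first t steps, and is then completely determined, or it is known
    above k = 2n - 2t and the remainder has the same form as at the start. *)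
Lemma even_prefix (R : realType) (n : nat) (a : digits) (t : nat) :
  (1 <= n)%N -> knott_expansion R (lucas (2 * n)) a -> (t <= 2 * n)%N ->
  (exists2 u, (u < t)%N & a = digits_of (even_positions n u)) \/
  (tail R a (2 * n%:Z - 2 * t%:Z) =
     phi R ^ (2 * n%:Z - 2 * t%:Z) + phi R ^ (- (2 * n%:Z)) /\
   forall i, 2 * n%:Z - 2 * t%:Z < i -> a i = (i \in run 2 (2 * n%:Z - 1) t)).
Proof.
move=> n1 [aN Ka]; elim: t => [|t IH] tn.
  right; rewrite mulr0 subr0 -lucas_even.
  have [|tN a0] := expansion_tail (k := 2 * n%:Z) aN.
    (* L_(2n) < phi ^ (2n + 1) is where 1 <= n matters: for n = 0, L_0 = 2 > phi. *)
    rewrite lucas_even (@phiz_rec R (2 * n%:Z - 1) (2 * n%:Z) (2 * n%:Z + 1)); [|lia..].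
    by rewrite ltrD2l ltr_phiz; lia.
  by split=> // i /a0 ->; rewrite run2E; lia.
have {IH} [] := IH (ltnW tn); first by move=> [u ut ->]; left; exists u => //; lia.
set k := 2 * n%:Z - 2 * t%:Z => -[tk hi]; have kE := erefl : k = 2 * n%:Z - 2 * t%:Z.
case ak: (a k).
  left; exists t => //; apply: (digits_ext (k := k)) => i ik.
    by rewrite mem_cat hi // tn run2E !inE; lia.
  have [->|ne] := eqVneq i k; first by rewrite ak mem_cat tn !inE eqxx orbT.
  rewrite (@tail_phiz_below R a (- (2 * n%:Z)) (k - 1)) //; [|lia| |lia].
    by rewrite mem_cat tn run2E !inE; lia.
  by rewrite tail_digit1 // tk addrC addKr.
right.
have t1 : tail R a (k - 1) = phi R ^ k + phi R ^ (- (2 * n%:Z)).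
  by rewrite tail_digit0.
have a1 : a (k - 1) = true.
  by apply: (@digit1 R); rewrite t1 subrK lerDl ltW ?phiz_gt0.
have -> : 2 * n%:Z - 2 * t.+1%:Z = k - 2 by lia.
split.
  rewrite (_ : k - 2 = k - 1 - 1); last by lia.
  rewrite tail_digit1 // t1 (@phiz_rec R (k - 1 - 1) (k - 1) k); [|lia..].
  ring.
move=> i ik; have [ki|ki] := ltP k i; first by rewrite hi // !run2E; lia.
have [->|ne] := eqVneq i k; first by rewrite ak run2E; lia.
have -> : i = k - 1 by lia.
by rewrite a1 run2E; lia.
Qed.

Lemma even_classification (R : realType) (n : nat) (a : digits) :
  (1 <= n)%N -> knott_expansion R (lucas (2 * n)) a ->
  exists2 t, (t < 2 * n + 1)%N & a = digits_of (even_positions n t).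
Proof.
move=> n1 Ka; have [[u un ->]|] := even_prefix n1 Ka (leqnn _).
  by exists u => //; lia.
rewrite (_ : 2 * n%:Z - 2 * (2 * n)%N%:Z = - (2 * n%:Z)); last by lia.
set c := - (2 * n%:Z) => -[tc hi]; have cE := erefl : c = - (2 * n%:Z).
(* With a 0 at c, the positions below c would have to carry 2 phi ^ c, which
   exceeds phi ^ (c + 1). *)
have ac : a c = true.
  apply/negPn/negP => /negbTE ac; have := tail_lt R a (c - 1).
  rewrite tail_digit0 // tc (_ : c - 1 + 2 = c + 1); last by lia.
  rewrite (@phiz_rec R (c - 1) c (c + 1)); [|lia..].
  rewrite ltrD2l ltr_phiz; lia.
exists (2 * n)%N; first by lia.
apply: (digits_ext (k := c)) => i ic; rewrite mem_cat ltnn run1E.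
  by rewrite hi // run2E; lia.
have [->|ne] := eqVneq i c; first by rewrite ac; lia.
rewrite (@tail_phiz_above R a (c - 1)); [|by case: Ka| |lia].
  by rewrite run2E; lia.
by rewrite tail_digit1 // tc subrK addrK.
Qed.

(** The same invariant as in [even_prefix], now with k = 2n + 1 - 2t; the digit at
    k is part of what is known, because the remainder is less than phi ^ k. *)
Lemma odd_prefix (R : realType) (n : nat) (a : digits) (t : nat) :
  (1 <= n)%N -> knott_expansion R (lucas (2 * n + 1)) a -> (t <= 2 * n)%N ->
  (exists2 u, (u < t)%N & a = digits_of (odd_positions n u)) \/
  (tail R a (2 * n%:Z + 1 - 2 * t%:Z) =
     phi R ^ (2 * n%:Z + 1 - 2 * t%:Z) - phi R ^ (- (2 * n%:Z) - 1) /\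
   forall i, 2 * n%:Z + 1 - 2 * t%:Z <= i -> a i = (i \in run 2 (2 * n%:Z) t)).
Proof.
move=> n1 [aN Ka]; elim: t => [|t IH] tn.
  right; rewrite mulr0 subr0 -lucas_odd.
  have N1 : (lucas (2 * n + 1))%:R < phi R ^ (2 * n%:Z + 1).
    by rewrite lucas_odd ltrBlDr ltrDl phiz_gt0.
  have [] := expansion_tail (k := 2 * n%:Z) aN; first by [].
  move=> tN a0; split.
    by rewrite -tN -[in RHS](addrK 1 (2 * n%:Z)) tail_digit0 // a0 //; lia.
  by move=> i ik; rewrite a0 ?run2E; lia.
have {IH} [] := IH (ltnW tn); first by move=> [u ut ->]; left; exists u => //; lia.
set k := 2 * n%:Z + 1 - 2 * t%:Z => -[tk hi]; have kE := erefl : k = 2 * n%:Z + 1 - 2 * t%:Z.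
set c := - (2 * n%:Z) - 1 in tk *; have cE := erefl : c = - (2 * n%:Z) - 1.
have ak : a k = false by rewrite hi // run2E; lia.
have t1 : tail R a (k - 1) = phi R ^ k - phi R ^ c by rewrite tail_digit0.
have pk : phi R ^ k = phi R ^ (k - 1) + phi R ^ (k - 2) by apply: phiz_rec; lia.
case a1: (a (k - 1)); last first.
  left; exists t => //.
  (* The digits are 1 down to c + 1 and leave phi ^ (c + 1) for the positions
     up to c. *)
  have [||tc ones] := @tail_ones R a c (k - 2); first by lia.
    rewrite subrK -t1 -(@tail_digit0 R a (k - 1)) //.
    by congr tail; lia.
  apply: (digits_ext (k := k - 1)) => i ik; rewrite mem_cat tn run1E.
    by rewrite hi ?run2E; lia.
  rewrite run2E.
  have [->|ne] := eqVneq i (k - 1); first by rewrite a1; lia.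
  have [ci|ci] := ltP c i; first by rewrite ones; lia.
  by rewrite (@tail_phiz_above R a c) //; lia.
right.
have -> : 2 * n%:Z + 1 - 2 * t.+1%:Z = k - 2 by lia.
have t2 : tail R a (k - 2) = phi R ^ (k - 2) - phi R ^ c.
  rewrite (_ : tail R a (k - 2) = tail R a (k - 1 - 1)); last by congr tail; lia.
  by rewrite tail_digit1 // t1 pk; ring.
split=> // i ik; have [ki|ki] := leP k i; first by rewrite hi // !run2E; lia.
have [->|ne] := eqVneq i (k - 1); first by rewrite a1 run2E; lia.
have -> : i = k - 2 by lia.
rewrite run2E (@digit0 R a (k - 2)); first by lia.
by rewrite t2 ltrBlDr ltrDl phiz_gt0.
Qed.

Lemma odd_classification (R : realType) (n : nat) (a : digits) :
  (1 <= n)%N -> knott_expansion R (lucas (2 * n + 1)) a ->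
  exists2 t, (t < 2 * n + 1)%N & a = digits_of (odd_positions n t).
Proof.
move=> n1 Ka; have [[u un ->]|] := odd_prefix n1 Ka (leqnn _).
  by exists u => //; lia.
rewrite (_ : 2 * n%:Z + 1 - 2 * (2 * n)%N%:Z = - (2 * n%:Z) + 1); last by lia.
set c := - (2 * n%:Z) => -[tc hi]; have cE := erefl : c = - (2 * n%:Z).
(* The descent ends at c + 1, where phi ^ (c + 1) - phi ^ (c - 1) = phi ^ c. *)
exists (2 * n)%N; first by lia.
apply: (digits_ext (k := c + 1)) => i ic; rewrite mem_cat ltnn inE.
  by rewrite hi ?run2E; lia.
rewrite (@tail_phiz_below R a c (c + 1)) //; [|by case: Ka|lia|].
  by rewrite run2E; lia.
by rewrite tc (@phiz_rec R (c - 1) c (c + 1)) ?addrK //; lia.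
Qed.

Theorem theorem3p3 (R : realType) (n : nat) (hn : (1 <= n)%N) :
  tot_knott R (lucas (2 * n)%N) = (2 * n + 1)%N /\
  tot_knott R (lucas (2 * n + 1)%N) = (2 * n + 1)%N.
Proof.
split.
- apply: (card_fset_set_param (w := fun t => digits_of (even_positions n t))).
  + by move=> t tn; apply: even_knott; lia.
  + by move=> a; apply: even_classification.
  + by move=> t u tu; apply: even_positions_inj; lia.
- apply: (card_fset_set_param (w := fun t => digits_of (odd_positions n t))).
  + by move=> t tn; apply: odd_knott; lia.
  + by move=> a; apply: odd_classification.
  + by move=> t u tu; apply: odd_positions_inj; lia.
Qed.
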